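(* Let $X$ be a hereditarily unicoherent continuum. Then every meager composant of $X$ is closed in $X$ if and only if every indecomposable subcontinuum of $X$ is nowhere dense in $X$.
   Context: A continuum is a nonempty compact connected metric space; a subcontinuum of $X$ is a subset of $X$ that is a continuum in the subspace topology (one-point sets are allowed as subcontinua). A continuum $X$ is hereditarily unicoherent if for every two subcontinua $A,B$ of $X$ the intersection $A\cap B$ is connected (the empty set counts as connected). A continuum is decomposable if it is the union of two of its proper subcontinua; otherwise it is indecomposable. For a continuum $X$ and $x\in X$, the meager composant of $x$ in $X$ is $M_x=\bigcup\{L\subset X: L$ is a nowhere dense subcontinuum of $X$ and $x\in L\}$; the meager composants of $X$ are the sets $M_x$, $x\in X$.
   Formalization: X is additionally assumed to have at least two points; for a one-point X the claim fails, since its only meager composant is empty (hence closed) while X itself is an indecomposable subcontinuum that is not nowhere dense. *)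

(* Defs.v *)
From mathcomp Require Import all_boot all_order all_algebra.
From mathcomp Require Import all_classical all_reals all_analysis.

Set Implicit Arguments.
Unset Strict Implicit.
Unset Printing Implicit Defensive.

Local Open Scope classical_set_scope.

(* The space X is the whole type, X : metricType R; subcontinua are sets in X.
   For a subset, [compact] and [connected] agree with compactness and
   connectedness of the subspace topology, and [connected set0] holds. *)

Definition continuum (T : topologicalType) (A : set T) : Prop :=
  [/\ A !=set0, compact A & connected A].

Definition hereditarily_unicoherent (T : topologicalType) : Prop :=
  forall A B : set T, continuum A -> continuum B -> connected (A `&` B).

Definition decomposable (T : topologicalType) (K : set T) : Prop :=
  exists A B : set T,
    [/\ continuum A, continuum B, A `<` K, B `<` K & A `|` B = K].

(* One-point continua are indecomposable. If X is a single point, that point is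
   therefore an indecomposable subcontinuum that is not nowhere dense, while
   the only meager composant is empty, hence closed. *)
Definition indecomposable (T : topologicalType) (K : set T) : Prop :=
  continuum K /\ ~ decomposable K.

Definition nowhere_dense (T : topologicalType) (A : set T) : Prop :=
  interior (closure A) = set0.

Definition meager_composant (T : topologicalType) (x : T) : set T :=
  \bigcup_(L in [set L : set T | [/\ continuum L, nowhere_dense L & L x]]) L.

(* Main.v *)
From HB Require Import structures.
Require Import Defs.
From mathcomp Require Import all_boot all_order all_algebra.
From mathcomp Require Import all_classical all_reals all_analysis.

(* By hereditary unicoherence and compactness, the intersection [I(S)] of all
   subcontinua containing a nonempty set [S] is a continuum.

   Suppose [y] is in the closure of [M_x] but not in [M_x]. Then [I({x, y})] has
   interior points; let [V] be a nonempty open subset of it missing [y]. The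
   continuum [I(V)] is indecomposable: if it were the union of proper subcontinua
   [A] and [B], a continuum [C] in [I({x, y}) \ V] from [y] to the closure of [V]
   would meet, say, [A]; as [M_x] is dense in [V], a nowhere dense continuum [L]
   joins [x] to a point of [V \ B], hence to [A]; then the continuum
   [L + A + C] contains [x] and [y], hence [V], so [L] contains the nonempty
   open set [V \ A].

   Conversely, let [K] be indecomposable with an interior point [x]. Proper
   subcontinua of [K] are nowhere dense and, by boundary bumping, those
   containing [x] have a dense union in [K], so [K] lies in [M_x] if [M_x] is
   closed. But [M_x] meets [K] in a countable union of proper subcontinua (the
   components of [x] in [K \ U], [U] basic open), against Baire's theorem. *)

Set Implicit Arguments.
Unset Strict Implicit.
Unset Printing Implicit Defensive.

Local Open Scope classical_set_scope.

(** * Directed intersections of closed sets in a compact Hausdorff space *)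

Lemma closed_separation (T : topologicalType) (A B : set T) :
  hausdorff_space T -> compact [set: T] -> closed A -> closed B ->
  A `&` B = set0 ->
  exists U V, [/\ open U, open V, A `<=` U, B `<=` V & U `&` V = set0].
Proof.
move=> hT cT cA cB /disjoints_subset AB.
have /(compact_normal hT cT cA) [W /set_nbhsP[U [oU AU UW]] cWB] :
    set_nbhs A (~` B).
  by apply/set_nbhsP; exists (~` B); split=> //; exact: closed_openC.
exists U, (~` closure W); split => //.
- exact/closed_openC/closed_closure.
- exact: subsetCr.
- by apply/disjoints_subset; rewrite setCK => z /UW; exact: subset_closure.
Qed.

Definition directed (T : Type) (F : set (set T)) :=
  F !=set0 /\ forall A B, F A -> F B -> exists2 C, F C & C `<=` A `&` B.

(** Otherwise the sets [A \ O] generate a proper filter, and a cluster point of it lies in every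
    member of [F] but not in [O]. *)
Lemma bigcap_directed_sub (T : topologicalType) (F : set (set T)) (O : set T) :
  compact [set: T] -> directed F -> (forall A, F A -> closed A) -> open O ->
  \bigcap_(A in F) A `<=` O -> exists2 A, F A & A `<=` O.
Proof.
move=> cT [F0 dF] cF oO FO; apply: contrapT => nF.
have PF : ProperFilter (filter_from F (fun A => A `\` O)).
  apply: filter_from_proper.
    apply: filter_from_filter => // A B FA FB; have [C FC CAB] := dF _ _ FA FB.
    by exists C => // z [/CAB[Az Bz] nOz].
  move=> A FA; apply/set0P/negP => /eqP; rewrite setD_eq0 => AO.
  by apply: nF; exists A.
have [p [_ Fp]] := cT _ PF filterT.
have Fclp A : F A -> (A `\` O) p.
  move=> FA; have cAO : closed (A `\` O).
    by apply: closedI; [exact: cF | exact: open_closedC].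
  rewrite ((closure_id _).1 cAO) closureEnbhs => U V AU Vp.
  by apply: Fp => //; exists A.
have [A FA] := F0; have [_] := Fclp A FA; apply; apply: FO => B /Fclp[].
by [].
Qed.

Lemma bigcap_directed_neq0 (T : topologicalType) (F : set (set T)) :
  compact [set: T] -> directed F -> (forall A, F A -> closed A) ->
  (forall A, F A -> A !=set0) -> \bigcap_(A in F) A !=set0.
Proof.
move=> cT dF cF F0; apply/set0P/negP => /eqP FE.
have [||A FA] := @bigcap_directed_sub _ F set0 cT dF cF; first exact: open0.
  by rewrite FE.
by rewrite subset0 => A0; have := F0 _ FA; rewrite A0 => -[].
Qed.

(** The two halves of a separation of the intersection are closed; disjoint open neighbourhoods of
    them cover some member [A], and [split_F] then puts the intersection inside one of them.
    Assuming [split_F] instead of connected members makes the lemma apply to families of clopen sets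
    as well. *)
Lemma bigcap_directed_connected (T : topologicalType) (F : set (set T)) :
  hausdorff_space T -> compact [set: T] -> directed F ->
  (forall A, F A -> closed A) ->
  (forall A U V, F A -> open U -> open V -> U `&` V = set0 ->
     A `<=` U `|` V -> \bigcap_(A in F) A `<=` U \/ \bigcap_(A in F) A `<=` V) ->
  connected (\bigcap_(A in F) A).
Proof.
move=> hT cT dF cF split_F; set Z := \bigcap_(A in F) A.
have cZ : closed Z by exact: closed_bigI.
apply/connectedP => E [E0 ZE [sE1 sE2]].
(* The closure of each half stays in the closed set [Z] and misses the other half. *)
have cE b : closed (E b).
  have EZ : closure (E b) `<=` Z.
    rewrite [Z]((closure_id Z).1 cZ); apply: closureS; rewrite ZE.
    by case: b; [exact: subsetUr | exact: subsetUl].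
  have -> : E b = closure (E b); last exact: closed_closure.
  apply/seteqP; split; first exact: subset_closure.
  move=> z Ebz; have := EZ _ Ebz; rewrite ZE; case: b Ebz {EZ} => Ebz [] // Ez.
  - by have : set0 z by rewrite -sE2.
  - by have : set0 z by rewrite -sE1.
have [|U [V [oU oV EU EV UV]]] :=
    closed_separation hT cT (cE false) (cE true).
  by rewrite ((closure_id _).1 (cE false)).
have ZUV : Z `<=` U `|` V by rewrite ZE; exact: setUSS.
have [A FA AUV] := bigcap_directed_sub cT dF cF (openU oU oV) ZUV.
have [[z1 E1z] [z0 E0z]] := (E0 true, E0 false).
have [ZU|ZV] := split_F _ _ _ FA oU oV UV AUV.
- suff : (U `&` V) z1 by rewrite UV.
  by split; [apply: ZU; rewrite -/Z ZE; right | exact: EV].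
- suff : (U `&` V) z0 by rewrite UV.
  by split; [exact: EU | apply: ZV; rewrite -/Z ZE; left].
Qed.

Lemma separated_open (T : topologicalType) (U V : set T) :
  open U -> open V -> U `&` V = set0 -> separated U V.
Proof.
move=> oU oV UV; split; apply/disjoints_subset.
  rewrite ((closure_id _).1 (open_closedC oV)).
  exact/closureS/disjoints_subset.
apply: subsetCr; rewrite ((closure_id _).1 (open_closedC oU)).
by apply/closureS/disjoints_subset; rewrite setIC.
Qed.

Lemma bigcap_directed_continuum (T : topologicalType) (F : set (set T)) :
  hausdorff_space T -> compact [set: T] -> directed F ->
  (forall A, F A -> continuum A) -> continuum (\bigcap_(A in F) A).
Proof.
move=> hT cT dF cF.
have clF A : F A -> closed A by move=> /cF[_ + _]; exact: compact_closed.
split.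
- by apply: bigcap_directed_neq0 => // A /cF[].
- by apply: subclosed_compact cT _ => //; exact: closed_bigI.
- apply: bigcap_directed_connected => // A U V FA oU oV UV AUV.
  have [_ _ coA] := cF _ FA.
  have [AU|AV] := connected_subset (separated_open oU oV UV) AUV coA.
    by left => z Fz; apply: AU; exact: Fz.
  by right => z Fz; apply: AV; exact: Fz.
Qed.

(** * The least continuum containing a set *)

Definition continuum_hull (T : topologicalType) (S : set T) : set T :=
  \bigcap_(A in [set A | continuum A /\ S `<=` A]) A.

Lemma sub_continuum_hull (T : topologicalType) (S : set T) :
  S `<=` continuum_hull S.
Proof. by move=> z Sz A [_]; exact. Qed.

Lemma continuum_hull_sub (T : topologicalType) (S A : set T) :
  continuum A -> S `<=` A -> continuum_hull S `<=` A.
Proof. by move=> cA SA z; apply. Qed.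

(** Hereditary unicoherence makes the family of continua containing [S] closed under pairwise
    intersection, hence directed; a point of [S] keeps these intersections nonempty. *)
Lemma continuum_hullP (T : topologicalType) (S : set T) :
  hausdorff_space T -> continuum [set: T] -> hereditarily_unicoherent T ->
  S !=set0 -> continuum (continuum_hull S).
Proof.
move=> hT contT hu [s Ss]; have [_ cT _] := contT.
apply: bigcap_directed_continuum => //; last by move=> A [].
split; first by exists setT.
move=> A B [cA SA] [cB SB]; exists (A `&` B) => //; split; last first.
  by move=> z Sz; split; [exact: SA | exact: SB].
split; last exact: hu.
- by exists s; split; [exact: SA | exact: SB].
- have [[_ kA _] [_ kB _]] := (cA, cB).
  by apply: compact_closedI => //; exact: compact_closed.
Qed.

(** * Proper subcontinua of indecomposable continua *)

(** In a separation of the union of [L] and [E], the connected set [L] lies in one piece, so the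
    other piece is contained in [E] and is separated from [F] too; adding [F] to the first piece
    would then separate [K]. *)
Lemma connectedU_separated (T : topologicalType) (K L E F : set T) :
  connected K -> connected L -> separated E F -> K `\` L = E `|` F ->
  L `<=` K -> connected (L `|` E).
Proof.
move=> coK coL sEF KL LK; have [sEF1 sEF2] := sEF.
apply/connectedP => G [G0 LE sG].
have [b LG] : exists b, L `<=` G b.
  have LG : L `<=` G false `|` G true by rewrite -LE; exact: subsetUl.
  by have [] := connected_subset sG LG coL; [exists false | exists true].
have GLE c : G c `<=` L `|` E.
  by rewrite LE; case: c; [exact: subsetUr | exact: subsetUl].
have {sG} [sG1 sG2] : separated (G b) (G (~~ b)).
  by case: b {LG} => //=; rewrite separatedC.
have GbNE : G (~~ b) `<=` E.
  move=> z Gz; have [/LG Gbz|//] := GLE _ _ Gz.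
  suff : set0 z by [].
  by rewrite -sG1; split => //; exact: subset_closure.
have sK : separated (G b `|` F) (G (~~ b)).
  split.
    rewrite closureU setIUl sG1 set0U.
    apply/disjoints_subset/subsetCr => z /GbNE Ez Fz.
    by have : set0 z by rewrite -sEF2.
  rewrite setIUl sG2 set0U; apply/disjoints_subset => z Fz /(closureS GbNE) Ez.
  by have : set0 z by rewrite -sEF1.
have KG : K `<=` (G b `|` F) `|` G (~~ b).
  move=> z Kz; suff : (L `|` E `|` F) z.
    by rewrite LE; case: (b); rewrite /setU /=; tauto.
  have [Lz|Lz] := pselect (L z); first by left; left.
  have : (E `|` F) z by rewrite -KL.
  by case=> ?; [left; right | right].
have GK c : G c `<=` K.
  move=> z /GLE[/LK //|Ez].
  have : (K `\` L) z by rewrite KL; left.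
  by case.
have [p Gp] := G0 b; have [q Gq] := G0 (~~ b).
have dis := separated_disjoint sK.
have [KG1|KG2] := connected_subset sK KG coK.
  suff : set0 q by []; rewrite -dis; split=> //; exact/KG1/(GK (~~ b)).
suff : set0 p by []; rewrite -dis; split; first by left.
exact/KG2/(GK b).
Qed.

(** If [L] had an interior point, [K] would decompose: into [L] and the closure of [K \ L] when
    [K \ L] is connected, and otherwise into the unions of [L] with the two pieces of a separation
    of [K \ L]. *)
Lemma indecomposable_proper_nowhere_dense (T : topologicalType) (K L : set T) :
  hausdorff_space T -> indecomposable K -> continuum L -> L `<` K ->
  nowhere_dense L.
Proof.
move=> hT [[K0 cK coK] indK] contL [LK nKL]; have [L0 cL coL] := contL.
have clK := compact_closed hT cK; have clL := compact_closed hT cL.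
rewrite /nowhere_dense -((closure_id _).1 clL).
apply: contrapT => /eqP/set0P[p Lp]; apply: indK.
have subcontinuum A : closed A -> A `<=` K -> A !=set0 -> connected A ->
    continuum A.
  by move=> cA AK A0 coA; split=> //; exact: subclosed_compact cA cK AK.
have [q [Kq Lq]] : K `\` L !=set0 by apply/set0P/eqP; rewrite setD_eq0.
have clKL : closure (K `\` L) `<=` K.
  by rewrite [X in _ `<=` X]((closure_id K).1 clK); apply: closureS => z [].
have [coKL|/connectedPn[E [E0 KLE sE]]] := pselect (connected (K `\` L)).
  have KLp : ~ closure (K `\` L) p.
    have Lp' : nbhs p L° by exact: nbhs_interior.
    by move=> /(_ _ Lp')[z [[_ Lz]]]; move/interior_subset.
  exists (closure (K `\` L)), L; split => //.
  - apply: subcontinuum => //; first exact: closed_closure.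
    + by exists q; exact: subset_closure.
    + exact: connected_closure.
  - by split=> // /(_ p)/(_ (LK _ (interior_subset Lp))).
  - apply/seteqP; split; first by rewrite subUset.
    move=> z Kz; have [Lz|Lz] := pselect (L z); first by right.
    by left; apply: subset_closure.
have EKL b : E b `<=` K `\` L.
  by rewrite KLE; case: b; [exact: subsetUr | exact: subsetUl].
have {}sE b : separated (E b) (E (~~ b)) by case: b => //=; rewrite separatedC.
have {}KLE b : K `\` L = E b `|` E (~~ b) by case: b => //=; rewrite setUC.
have LEK b : L `|` E b `<=` K by move=> z [/LK//|/EKL[]].
have contLE b : continuum (L `|` E b).
  apply: subcontinuum => //.
  (* A limit point of [E b] outside [L] lies in [K \ L] but not in the other piece, hence in
     [E b]. *)
  - have [sE1 _] := sE b; apply/closure_id/seteqP.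
    split; first exact: subset_closure.
    rewrite closureU -((closure_id _).1 clL) => z [|Ez]; first by left.
    have [Lz|Lz] := pselect (L z); first by left.
    have : (K `\` L) z.
      by split=> //; apply: clKL; apply: closureS Ez; exact: EKL.
    rewrite (KLE b) => -[|Ez']; first by right.
    by have : set0 z by rewrite -sE1.
  - by have [z Lz] := L0; exists z; left.
  - exact: connectedU_separated (KLE b) _.
have properLE b : L `|` E b `<` K.
  split=> // KLb; have [z Ez] := E0 (~~ b); have [Kz Lz] := EKL _ _ Ez.
  have [//|Ez'] := KLb _ Kz.
  by suff : set0 z by []; rewrite -(separated_disjoint (sE b)).
exists (L `|` E false), (L `|` E true); split => //.
rewrite setUACA setUid -(KLE false); apply/seteqP; split => z.
  by move=> [/LK//|[]].
by move=> Kz; have [Lz|Lz] := pselect (L z); [left | right].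
Qed.

(** * Boundary bumping *)

(** [C] is the quasi-component of [x] in [K \ V]. If it missed [closure V], then by compactness so
    would some relatively clopen [E] containing [x]; such an [E] is clopen in [K], hence equal to
    [K], although [K] meets [V]. *)
Lemma boundary_bumping (T : topologicalType) (K V : set T) (x : T) :
  hausdorff_space T -> compact [set: T] -> continuum K -> open V ->
  K `&` V !=set0 -> K x -> ~ V x ->
  exists C, [/\ continuum C, C x, C `<=` K `\` V & C `&` closure V !=set0].
Proof.
move=> hT cT [_ cK coK] oV [v [Kv Vv]] Kx Vx.
have clZ : closed (K `\` V).
  by apply: closedI; [exact: compact_closed | exact: open_closedC].
set Z := K `\` V in clZ *.
(* The clopen subsets of Z containing x: they intersect in a connected set. *)
pose F := [set E | [/\ E x, E `<=` Z, closed E & closed (Z `\` E)]].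
have dF : directed F.
  split; first by exists Z; split => //; rewrite setDv; exact: closed0.
  move=> A B [Ax AZ cA cAZ] [Bx BZ cB cBZ]; exists (A `&` B) => //.
  split => //; [by move=> z [/AZ] | exact: closedI |].
  by rewrite setDIr; exact: closedU.
have cF A : F A -> closed A by case.
pose C := \bigcap_(E in F) E.
have clC : closed C by exact: closed_bigI.
have Cx : C x by move=> E [].
have CZ : C `<=` Z.
  by move=> z; apply; split => //; rewrite setDv; exact: closed0.
(* The part of [A] in [U] equals [A \ W], so it is again a clopen subset of [Z] containing [x], and
   thus contains [C]. *)
have splitF A U W : F A -> open U -> open W -> U `&` W = set0 ->
    A `<=` U `|` W -> U x -> C `<=` U.
  move=> [Ax AZ cA cAZ] oU oW UW AUW Ux z Cz.
  have [] // : (A `&` U) z.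
  apply: Cz; split => //; first by move=> w [/AZ].
    have -> : A `&` U = A `\` W.
      apply/seteqP; split=> w [Aw].
        by move=> Uw; split=> // Ww; have : set0 w by rewrite -UW.
      by move=> Ww; split=> //; have [] := AUW _ Aw.
    by apply: closedI => //; exact: open_closedC.
  have -> : Z `\` (A `&` U) = (Z `\` A) `|` (A `\` U).
    rewrite setDIr; apply/seteqP; split => w [ZA|[ZA Uw]]; try by left.
      by have [Aw|Aw] := pselect (A w); [right|left].
    by right; split=> //; exact: AZ.
  by apply: closedU => //; apply: closedI => //; exact: open_closedC.
exists C; split => //.
- split; first by exists x.
    exact: subclosed_compact clC cT _.
  apply: bigcap_directed_connected => // A U W FA oU oW UW AUW.
  have [Ax _ _ _] := FA.
  have [Ux|Wx] := AUW _ Ax; [left | right].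
    exact: (splitF A U W).
  by apply: (splitF A W U) => //; rewrite 1?setIC 1?setUC.
apply/set0P/negP => /eqP /disjoints_subset CV.
have [E [Ex EZ cE cEZ] EV] := bigcap_directed_sub cT dF cF
  (closed_openC (@closed_closure _ V)) CV.
suff EK : E = K by have [_] := EZ v (ltac:(by rewrite EK)).
apply: coK; first by exists x.
(* Within [K], the points outside both [Z \ E] and [closure V] are exactly those of [E], so [E] is
   open in [K]. *)
- exists (~` (Z `\` E) `&` ~` closure V).
    by apply: openI; apply: closed_openC => //; exact: closed_closure.
  apply/seteqP; split => w.
    move=> Ew; have [Kw _] := EZ _ Ew; split => //; split; last exact: EV.
    by case.
  move=> [Kw [ZEw Vw]]; apply: contrapT => Ew; apply: ZEw; split => //.
  by split => // /subset_closure.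
- by exists E => //; apply/esym/setIidPr => w /EZ[].
Qed.

(** * Baire category in compact Hausdorff spaces *)

Lemma open_sub_nowhere_dense (T : topologicalType) (V A : set T) :
  open V -> V `<=` A -> nowhere_dense A -> V = set0.
Proof.
move=> oV VA A0; rewrite -subset0 -A0 -((interior_id _).1 oV).
by apply: interiorS => z /VA; exact: subset_closure.
Qed.

(** Starting from [O], nonempty open sets are chosen so that the closure of each lies in the
    preceding one minus [F n]; by compactness the closures have a common point. *)
Lemma compact_meager_sequence (T : topologicalType) (F : nat -> set T) :
  hausdorff_space T -> compact [set: T] ->
  (forall n, closed (F n) /\ nowhere_dense (F n)) ->
  dense (~` \bigcup_n F n).
Proof.
move=> hT cT FP O O0 oO.
pose W0 := {W : set T | open W /\ W !=set0}.
have step (nW : nat * W0) : exists W' : W0,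
    closure (sval W') `<=` sval nW.2 `\` F nW.1.
  case: nW => n [W [oW [w Ww]]] /=; have [cFn Fn0] := FP n.
  have oWF : open (W `\` F n) by apply: openI => //; exact: closed_openC.
  have [q WFq] : W `\` F n !=set0.
    apply/set0P/negP => /eqP; rewrite setD_eq0 => WF.
    by have := open_sub_nowhere_dense oW WF Fn0; move: Ww => /[swap] ->.
  have [B qB BW] : filter_from (nbhs q) closure (W `\` F n).
    by apply: (compact_regular hT cT filterT); exact: open_nbhs_nbhs.
  have B0 : open B° /\ B° !=set0.
    by split; [exact: open_interior | exists q].
  exists (exist _ B° B0) => /=; apply: subset_trans BW.
  exact: (closureS (@interior_subset _ B)).
have [f fP] := choice step.
pose fix W n := if n is m.+1 then f (m, W m) else exist _ O (conj oO O0) : W0.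
have WS n : closure (sval (W n.+1)) `<=` sval (W n) `\` F n.
  exact: (fP (n, W n)).
have Wmono m n : (m <= n)%N -> closure (sval (W n)) `<=` closure (sval (W m)).
  elim: n => [|n IHn]; first by rewrite leqn0 => /eqP ->.
  rewrite leq_eqVlt => /orP[/eqP -> //|/IHn]; apply: subset_trans.
  by move=> z /WS[Wz _]; exact: subset_closure.
have [p Wp] : \bigcap_(A in range (fun n => closure (sval (W n)))) A !=set0.
  apply: bigcap_directed_neq0 => //.
  - split; first by exists (closure (sval (W 0%N))), 0%N.
    move=> _ _ [m _ <-] [n _ <-]; exists (closure (sval (W (maxn m n)))).
      by exists (maxn m n).
    by move=> z Wz; split; apply: Wmono Wz; rewrite ?leq_maxl ?leq_maxr.
  - by move=> _ [n _ <-]; exact: closed_closure.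
  - move=> _ [n _ <-]; have [w ?] := (svalP (W n)).2.
    by exists w; exact: subset_closure.
have {}Wp n : closure (sval (W n)) p by apply: Wp; exists n.
(* The closure of [W 0] may leave [O], so membership in [O] is read off at stage 1, and avoidance of
   [F n] at stage [n.+1]. *)
exists p; split; first by have [] := WS 0%N _ (Wp 1%N).
by move=> [n _]; have [] := WS n _ (Wp n.+1).
Qed.

Lemma compact_meager (T : topologicalType) (D : set (set T)) :
  hausdorff_space T -> compact [set: T] -> countable D ->
  (forall A, D A -> closed A /\ nowhere_dense A) ->
  dense (~` \bigcup_(A in D) A).
Proof.
move=> hT cT /pfcard_geP[->|[f]] DP.
  by rewrite bigcup_set0 setC0 => O O0 _; rewrite setIT.
have -> : \bigcup_(A in D) A = \bigcup_n f n.
  apply/seteqP; split => z.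
    by move=> [A /(@surj _ _ _ _ f)[n _ <-] fz]; exists n.
  by move=> [n _ fz]; exists (f n) => //; exact: funS.
by apply: compact_meager_sequence => // n; apply: DP; exact: funS.
Qed.

(** * Singletons, countable bases and unions of continua *)

(** A singleton with an interior point is clopen, hence the whole connected space. *)
Lemma nowhere_dense_set1 (T : topologicalType) (x : T) :
  hausdorff_space T -> connected [set: T] -> (exists y z : T, y <> z) ->
  nowhere_dense [set x].
Proof.
move=> hT coT [y [z yz]].
have clx : closed [set x].
  exact: accessible_closed_set1 (hausdorff_accessible hT) _.
rewrite /nowhere_dense -((closure_id _).1 clx).
apply: contrapT => /eqP/set0P[p xp].
have px : p = x by exact: interior_subset xp.
have x1 : [set x]° = [set x].
  by apply/seteqP; split=> [|w ->]; [exact: interior_subset | rewrite -{2}px].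
have xT : [set x] = [set: T].
  apply: coT; first by exists x.
    by exists [set x]; rewrite ?setTI// -x1; exact: open_interior.
  by exists [set x]; rewrite ?setTI.
have all_x w : w = x by have : [set: T] w by []; rewrite -xT.
by apply: yz; rewrite (all_x y) (all_x z).
Qed.

Lemma compact_metric_second_countable (R : realType) (X : metricType R) :
  compact [set: X] -> second_countable (T := X).
Proof.
move=> cX; have [x0|noX] := pselect (exists x : X, True); last first.
  exists set0; first exact: countable0.
  by split=> // x; case: noX; exists x.
have [x _] := cid x0.
(* The point [x] supplies the pointed structure required by [compact_second_countable]. *)
pose PX : pseudoPMetricType R := HB.pack X (isPointed.Build X x).
exact: (@compact_second_countable R PX).
Qed.

Lemma continuumU (T : topologicalType) (A B : set T) :
  continuum A -> continuum B -> A `&` B !=set0 -> continuum (A `|` B).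
Proof.
move=> [[a Aa] kA cA] [_ kB cB] AB; split.
- by exists a; left.
- exact: compactU.
- exact: connectedU.
Qed.

(** * Closed meager composants force indecomposable subcontinua to be nowhere dense *)

Lemma indecomposable_nowhere_dense (T : topologicalType) :
  hausdorff_space T -> second_countable (T := T) -> continuum [set: T] ->
  (exists y z : T, y <> z) -> hereditarily_unicoherent T ->
  (forall x : T, closed (meager_composant x)) ->
  forall K : set T, indecomposable K -> nowhere_dense K.
Proof.
move=> hT [B ctB [oB basisB]] [_ cT coT] nondeg hu clM K indK.
have [contK _] := indK; have [_ kK coK] := contK.
have clK := compact_closed hT kK.
apply: contrapT; rewrite /nowhere_dense -((closure_id _).1 clK).
move=> /eqP/set0P[x Kx'].
have Kx : K x by exact: interior_subset Kx'.
have nd1 : nowhere_dense [set x] by exact: nowhere_dense_set1.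
(* Each neighbourhood of [z] contains some [closure V]. Boundary bumping gives a continuum in [K]
   from [x] to it that omits [z], hence is nowhere dense; if [x] is already in [V°], the singleton
   of [x] serves. *)
have KM : K `<=` meager_composant x.
  move=> z Kz; rewrite ((closure_id _).1 (clM x)) => U zU.
  have [V zV VU] : filter_from (nbhs z) closure U.
    exact: (compact_regular hT cT filterT).
  have [Vx|Vx] := pselect (V° x).
    exists x; split; last first.
      by apply: VU; apply: subset_closure; exact: interior_subset Vx.
    exists [set x] => //; split => //; split; first by exists x.
      exact: compact_set1.
    exact: connected1.
  have [|C [contC Cx CKV [w [Cw Vw]]]] :=
      boundary_bumping hT cT contK (open_interior V) _ Kx Vx.
    by exists z.
  exists w; split; last by apply: VU; apply: closureS Vw; exact: interior_subset.
  exists C => //; split => //.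
  apply: (indecomposable_proper_nowhere_dense hT indK contC).
  by split=> [v /CKV[]//|/(_ z Kz)/CKV[_]]; apply.
pose BK := [set U | B U /\ K `&` U !=set0].
pose D := (fun U => connected_component (K `\` U) x) @` BK.
have ctD : countable D.
  apply: sub_countable ctB; apply: card_le_trans (card_image_le _ _) _.
  by apply: subset_card_le => U [].
have DP A : D A -> closed A /\ nowhere_dense A.
  move=> [U [BU [u [Ku Uu]]] <-].
  have clKU : closed (K `\` U).
    by apply: closedI => //; apply: open_closedC; exact: oB.
  have clC : closed (connected_component (K `\` U) x) by exact: component_closed.
  (* When [x] lies in [U], the component is the empty set. *)
  split=> //; have [KUx|KUx] := pselect ((K `\` U) x); last first.
    by rewrite connected_component_out// /nowhere_dense closure0 interior0.
  have CK : connected_component (K `\` U) x `<=` K.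
    by move=> z /connected_component_sub[].
  apply: (indecomposable_proper_nowhere_dense hT indK).
    split; last exact: component_connected.
      by exists x; exact: connected_component_refl.
    exact: subclosed_compact clC kK CK.
  by split=> // /(_ u Ku)/connected_component_sub[_]; apply.
have [|q [Kq]] := compact_meager hT cT ctD DP _ (open_interior K).
  by exists x.
have {}Kq : K q by exact: interior_subset Kq.
apply; have [L [contL ndL Lx] Lq] := KM _ Kq; have [_ kL _] := contL.
(* [L] omits some [r] in [K], hence a basic [U] around [r]. The intersection of [L] and [K] is
   connected by hereditary unicoherence, so the component of [x] in [K \ U] contains it, and with it
   [q]. *)
have [r [Kr Lr]] : K `\` L !=set0.
  apply/set0P/negP => /eqP; rewrite setD_eq0 => KL.
  have K0 : K° = set0.
    apply: (@open_sub_nowhere_dense _ _ L) => //; first exact: open_interior.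
    exact: subset_trans (@interior_subset _ K) KL.
  by rewrite K0 in Kx'.
have [U [BU Ur] UL] : filter_from [set U | B U /\ U r] id (~` L).
  apply: basisB; apply: open_nbhs_nbhs; split => //.
  have clL := compact_closed hT kL; exact: closed_openC.
exists (connected_component (K `\` U) x).
  by exists U => //; split => //; exists r.
apply: (@connected_component_max _ _ (L `&` K)) => //; last exact: hu.
by move=> z [Lz Kz]; split=> // /UL.
Qed.

(** * Nowhere dense indecomposable subcontinua force closed meager composants *)

Lemma meager_composant_closed (T : topologicalType) :
  hausdorff_space T -> continuum [set: T] ->
  (exists y z : T, y <> z) -> hereditarily_unicoherent T ->
  (forall K : set T, indecomposable K -> nowhere_dense K) ->
  forall x : T, closed (meager_composant x).
Proof.
move=> hT contT nondeg hu ndK x y My; have [_ cT coT] := contT.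
apply: contrapT => nMy.
have clMcont : continuum (closure (meager_composant x)).
  split; first by exists y.
    exact: subclosed_compact (@closed_closure _ _) cT _.
  apply: connected_closure; apply: bigcup_connected; last by move=> L [[]].
  by exists x => L [].
(* As [y] is a limit of [M_x], some nowhere dense [L] occurs in the union, and every such [L]
   contains [x]. *)
have Mx : closure (meager_composant x) x.
  have [z [[L LP _] _]] := My _ filterT.
  by apply: subset_closure; exists L => //; case: LP.
pose I := continuum_hull [set x; y].
have contI : continuum I by apply: continuum_hullP => //; exists x; left.
have IP A : continuum A -> A x -> A y -> I `<=` A.
  by move=> cA Ax Ay; apply: continuum_hull_sub => // z [] ->.
have [Ix Iy] : I x /\ I y.
  by split; apply: sub_continuum_hull; [left | right].
have IM : I `<=` closure (meager_composant x) by exact: IP.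
(* Removing [y] allows boundary bumping to start from [y]. *)
pose V := I° `&` ~` [set y].
have oV : open V.
  apply: openI; first exact: open_interior.
  exact/closed_openC/accessible_closed_set1/hausdorff_accessible.
have VI : V `<=` I by move=> z [/interior_subset].
(* Otherwise [I°] lies in the nowhere dense singleton of [y], so [I] is nowhere dense and puts [y]
   into [M_x]. *)
have V0 : V !=set0.
  apply/set0P/negP => /eqP /disjoints_subset; rewrite setCK => Iy1.
  apply: nMy; exists I => //; split=> //; rewrite /nowhere_dense.
  have [_ kI _] := contI.
  rewrite -((closure_id _).1 (compact_closed hT kI)).
  apply: open_sub_nowhere_dense Iy1 _; first exact: open_interior.
  exact: nowhere_dense_set1.
pose Q := continuum_hull V.
have contQ : continuum Q by exact: continuum_hullP.
have VQ : V `<=` Q by exact: sub_continuum_hull.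
have clQ : closed Q by have [_ kQ _] := contQ; exact: compact_closed.
have VnP A : continuum A -> A `<` Q -> V `\` A !=set0.
  move=> cA [_ QA]; apply/set0P/negP => /eqP; rewrite setD_eq0 => VA.
  by apply: QA; exact: continuum_hull_sub.
have oVD A : continuum A -> open (V `\` A).
  move=> [_ kA _]; apply: openI => //; apply: closed_openC.
  exact: compact_closed.
have [||C [contC Cy CIV [c [Cc Vc]]]] := boundary_bumping hT cT contI oV _ Iy _.
- by have [v Vv] := V0; exists v; split => //; exact: VI.
- by case=> _; apply.
(* Since [c] lies in [Q], it belongs to one half of any decomposition of [Q]; [splitQ] calls that
   half [A]. *)
have Qc : Q c by rewrite ((closure_id _).1 clQ); exact: closureS Vc.
have splitQ A B : continuum A -> continuum B -> A `<` Q -> B `<` Q ->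
    A `|` B = Q -> A c -> False.
  move=> cA cB AQ BQ ABQ Ac.
  have [a VBa] := VnP B cB BQ.
  have [m [[L [contL ndL Lx] Lm] [Vm Bm]]] :
      meager_composant x `&` (V `\` B) !=set0.
    apply: (IM a); first by apply: VI; case: VBa.
    by apply: open_nbhs_nbhs; split => //; exact: oVD.
  have Am : A m by have := VQ _ Vm; rewrite -ABQ => -[].
  have contLA : continuum (L `|` A) by apply: continuumU => //; exists m.
  have contLAC : continuum (L `|` A `|` C).
    by apply: continuumU => //; exists c; split => //; right.
  have ILAC : I `<=` L `|` A `|` C by apply: IP => //; [left; left | right].
  have [v VAv] := VnP A cA AQ.
  (* [V] lies in [I] and [C] misses [V], so what [A] leaves of [V] is covered by the nowhere dense
     [L]. *)
  have VA0 : V `\` A = set0.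
    apply: (@open_sub_nowhere_dense _ _ L) => //; first exact: oVD.
    move=> z [Vz Az]; have [[//|//]|/CIV[]//] := ILAC _ (VI _ Vz).
  by rewrite VA0 in VAv.
have V_eq0 : V = set0.
  apply: open_sub_nowhere_dense oV VQ _; apply: ndK; split => //.
  move=> [A [B [cA cB AQ BQ ABQ]]].
  have := Qc; rewrite -ABQ => -[Ac|Bc]; first exact: (splitQ A B).
  by apply: (splitQ B A) => //; rewrite setUC.
by have [v] := V0; rewrite V_eq0.
Qed.

Unset Implicit Arguments.

Theorem theorem9 (R : realType) (X : metricType R)
    (X_continuum : continuum [set: X])
    (X_nondegenerate : exists x y : X, x <> y)
    (X_hu : hereditarily_unicoherent X) :
  (forall x : X, closed (meager_composant x)) <->
  (forall K : set X, indecomposable K -> nowhere_dense K).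
Proof.
have hX := @metric_hausdorff _ X; have [_ cX _] := X_continuum.
have X2 := compact_metric_second_countable cX.
split; first exact: indecomposable_nowhere_dense.
exact: meager_composant_closed.
Qed.
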